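(* Let $r$ and $s$ be positive integers with $r\equiv2\pmod 3$ and $s\equiv2\pmod 6$. Then the Apéry numbers $a_n(r,s)$, $n\ge0$, obey the following congruences modulo $9$: (i) $a_n(r,s)\equiv 1\pmod 9$ if, and only if, the $3$-adic expansion of $n$ contains $6k$ digits $1$, for some $k$, and otherwise only $0$'s and $2$'s; (ii) $a_n(r,s)\equiv 2\pmod 9$ if, and only if, the $3$-adic expansion of $n$ contains $6k+5$ digits $1$, for some $k$, and otherwise only $0$'s and $2$'s; (iii) $a_n(r,s)\equiv 4\pmod 9$ if, and only if, the $3$-adic expansion of $n$ contains $6k+4$ digits $1$, for some $k$, and otherwise only $0$'s and $2$'s; (iv) $a_n(r,s)\equiv 5\pmod 9$ if, and only if, the $3$-adic expansion of $n$ contains $6k+1$ digits $1$, for some $k$, and otherwise only $0$'s and $2$'s; (v) $a_n(r,s)\equiv 7\pmod 9$ if, and only if, the $3$-adic expansion of $n$ contains $6k+2$ digits $1$, for some $k$, and otherwise only $0$'s and $2$'s; (vi) $a_n(r,s)\equiv 8\pmod 9$ if, and only if, the $3$-adic expansion of $n$ contains $6k+3$ digits $1$, for some $k$, and otherwise only $0$'s and $2$'s; (vii) in the cases not covered by Items (i)--(vi), $a_n(r,s)$ is divisible by $9$; in particular, $a_n(r,s)\not\equiv 3,6\pmod 9$ for all $n$.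
   Context: For non-negative integers $r,s,n$, the (generalised) Apéry numbers are $a_n(r,s)=\sum_{k=0}^n\binom nk^r\binom{n+k}k^s$. The $3$-adic expansion of $n$ is its base-$3$ representation $n=\sum_i n_i3^i$ with digits $0\le n_i\le 2$. In the items, $k$ denotes a non-negative integer. *)

(* Defs.v *)
From mathcomp Require Import all_boot.

Set Implicit Arguments.
Unset Strict Implicit.
Unset Printing Implicit Defensive.

Definition apery (r s n : nat) : nat :=
  \sum_(0 <= k < n.+1) 'C(n, k) ^ r * 'C(n + k, k) ^ s.

(* Least significant digit first, without leading zeros; since
   [trunc_log 3 0 = 0], the expansion of 0 is the single digit 0. *)
Definition ternary (n : nat) : seq nat :=
  mkseq (fun i => n %/ 3 ^ i %% 3) (trunc_log 3 n).+1.

(* The expansion of [n] contains exactly [m] digits 1 and otherwise only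
   0's and 2's. *)
Definition ternary_ones (n m : nat) : Prop :=
  count_mem 1 (ternary n) = m /\
  (forall d : nat, d \in ternary n -> d != 1 -> d = 0 \/ d = 2).

(* Main.v *)
(* Write m = 3n + d and l = 3k + e with digits d, e.  If e > d or d + e > 2,
   then 3 divides C(m, l) C(m + l, l), so the corresponding summand vanishes
   modulo 9.  For the remaining digits, C(3n, 3k) = C(n, k) (mod 9) and ratios
   of neighbouring binomials express (C(m, l) C(m + l, l))^2 through
   Y = (C(n, k) C(n + k, k))^2: it is Y for d = 0 or 2 and e = 0, while for
   d = 1 it is (1 + 3k) Y for e = 0 and (4 - 3k) Y for e = 1, of sum 5 Y.
   Hence each digit 1 multiplies the sum by 5, and a_n(2,2) is congruent to 5
   to the number of digits 1.  The exponents r, s may be replaced by 2 because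
   in a summand prime to 3 Lucas' theorem gives C(n, k) = 1 (mod 3), so that
   C(n, k)^3 = 1 (mod 9), while x^6 = 1 (mod 9) for all x prime to 3. *)

Require Import Defs.
From mathcomp Require Import all_boot.
From mathcomp Require Import all_algebra ring zify.

(** * Binomial coefficients modulo 3 and 9 *)

Lemma pascal3 m j :
  'C(m.+3, j.+3) = 'C(m, j.+3) + 3 * 'C(m, j.+2) + 3 * 'C(m, j.+1) + 'C(m, j).
Proof. rewrite !binS; lia. Qed.

(** Modulo 3 the middle terms of [pascal3] drop out, so passing from [n] to [n.+1] mirrors Pascal's
    rule for ['C(n, k)]. *)
Lemma lucas3 n k d e : d < 3 -> e < 3 ->
  'C(3 * n + d, 3 * k + e) = 'C(n, k) * 'C(d, e) %[mod 3].
Proof.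
move=> d3 e3; elim: n k => [|n IHn] [|k].
- by rewrite bin0 mul1n.
- by rewrite [in LHS]bin_small ?bin0n ?mul0n //; lia.
- have -> : 3 * n.+1 + d = (3 * n + d).+3 by lia.
  have := IHn 0; rewrite !bin0 !muln0 !add0n !mul1n => {IHn}.
  case: e e3 => [|[|[|//]]] _; first by rewrite !bin0.
  + rewrite !bin1; lia.
  + rewrite !binS !bin0; lia.
- have -> : 3 * n.+1 + d = (3 * n + d).+3 by lia.
  have -> : 3 * k.+1 + e = (3 * k + e).+3 by lia.
  rewrite pascal3 binS mulnDl.
  have -> : (3 * k + e).+3 = 3 * k.+1 + e by lia.
  move: (IHn k) (IHn k.+1); lia.
Qed.

Lemma dvd3_bin n k d e : d < e -> e < 3 -> 3 %| 'C(3 * n + d, 3 * k + e).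
Proof.
move=> de e3; rewrite /dvdn lucas3 ?(ltn_trans de) //.
by rewrite (bin_small de) muln0.
Qed.

(** Non-divisibility excludes e > d and carries, leaving last digits with e = 0 or d = e = 1; their
    Lucas factor is 1, never ['C(2, 1)]. *)
Lemma bin_mod3_eq1 n k :
  ~~ (3 %| 'C(n, k)) -> ~~ (3 %| 'C(n + k, k)) -> 'C(n, k) %% 3 = 1.
Proof.
elim/ltn_ind: n k => -[_ [|k]|n IHn k] //.
set m := n.+1 %/ 3; set d := n.+1 %% 3.
set l := k %/ 3; set e := k %% 3.
have -> : n.+1 = 3 * m + d by lia.
have -> : k = 3 * l + e by lia.
have mn : m < n.+1 by lia.
move: (IHn m mn l) => {}IHn; have d3 : d < 3 by lia.
have e3 : e < 3 by lia.
have [de|ed] := ltnP d e; first by rewrite dvd3_bin.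
(* As d < 3, a carry leaves the last digit d + e - 3 < e, so [dvd3_bin] applies. *)
have [carry|nocarry] := ltnP 2 (d + e).
  have -> : 3 * m + d + (3 * l + e) = 3 * (m + l).+1 + (d + e - 3) by lia.
  by rewrite [3 %| 'C(3 * (m + l).+1 + _, _)]dvd3_bin //; lia.
have -> : 3 * m + d + (3 * l + e) = 3 * (m + l) + (d + e) by lia.
rewrite /dvdn !lucas3 //; move: IHn; rewrite /dvdn.
have [-> | [-> ->]] : e = 0 \/ d = 1 /\ e = 1 by lia.
  by rewrite addn0 !bin0 !muln1.
rewrite binn bin1 muln1 => IHn nA nB; apply: IHn => //.
by apply: contra nB; rewrite -!/(dvdn _ _); apply: dvdn_mulr.
Qed.

(** In [pascal3] the two middle binomials are themselves divisible by 3, so with their coefficient 3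
    they vanish modulo 9 and Pascal's rule remains. *)
Lemma jacobsthal9 n k : 'C(3 * n, 3 * k) = 'C(n, k) %[mod 9].
Proof.
elim: n k => [|n IHn] [|k]; rewrite ?muln0 ?bin0 //.
have -> : 3 * n.+1 = (3 * n).+3 by lia.
have -> : 3 * k.+1 = (3 * k).+3 by lia.
rewrite pascal3 binS.
have h1 := @dvd3_bin n k 0 1 isT isT; have h2 := @dvd3_bin n k 0 2 isT isT.
have := IHn k.+1; rewrite mulnS !addSn add0n => h3.
move: h1 h2 h3 (IHn k); rewrite addn0 addn1 addn2; lia.
Qed.

(** * Ternary expansions *)

Lemma mkseqS (T : Type) (f : nat -> T) m :
  mkseq f m.+1 = f 0 :: mkseq (f \o S) m.
Proof. by rewrite /mkseq (map_comp f S) -(iotaDl 1 0). Qed.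

Lemma ternary_digit n : n < 3 -> ternary n = [:: n].
Proof. by case: n => [|[|[|]]]. Qed.

Lemma ternary_step n d : 0 < n -> d < 3 -> ternary (3 * n + d) = d :: ternary n.
Proof.
move=> n0 d3; rewrite /ternary.
have -> : trunc_log 3 (3 * n + d) = (trunc_log 3 n).+1.
  apply: trunc_log_eq => //.
  have := trunc_log_bounds (isT : 1 < 3) n0 => /=; rewrite !expnS; lia.
set f := fun i => _; set g := fun i => _.
rewrite mkseqS.
have -> : f 0 = d by rewrite /f expn0 divn1; lia.
congr cons; apply: eq_map => i; rewrite /f /g /= expnS divnMA.
by congr (_ %/ _ %% _); lia.
Qed.

Lemma ternary_lt3 n d : d \in ternary n -> d < 3.
Proof. by case/mapP => i _ ->; rewrite ltn_mod. Qed.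

Lemma count_ternary n d : d < 3 ->
  count_mem 1 (ternary (3 * n + d)) = (d == 1) + count_mem 1 (ternary n).
Proof.
(* For n = 0, [d :: ternary 0] has a leading zero that [ternary d] lacks; the count of 1's ignores
   it. *)
move=> d3; case: n => [|n]; last by rewrite ternary_step.
by rewrite muln0 !ternary_digit //= addn0.
Qed.

Lemma ternary_onesE n m : ternary_ones n m <-> count_mem 1 (ternary n) = m.
Proof.
split=> [[]//|cnt]; split=> // d /ternary_lt3; case: d => [|[|[|]]] //; auto.
Qed.

(** * Summands in a commutative ring where 9 = 0 *)

Section Mod9.

Import GRing.Theory.
Local Open Scope ring_scope.

Variables (R : comPzRingType) (char9 : 9%:R = 0 :> R).

(* [ring] cannot exploit 9 = 0, so the multiple of 9 is supplied explicitly. *)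
Lemma eq_mod9 (w x y : R) : x = y + 9%:R * w -> x = y.
Proof. by rewrite char9 mul0r addr0. Qed.

Lemma natr_mod9 m n : (m = n %[mod 9])%N -> m%:R = n%:R :> R.
Proof.
move=> mn; rewrite (divn_eq m 9) (divn_eq n 9) mn !natrD !natrM char9.
by rewrite !mulr0.
Qed.

Lemma natr_dvd3_exp m k : (3 %| m)%N -> (1 < k)%N -> m%:R ^+ k = 0 :> R.
Proof.
case/dvdnP => q ->; case: k => [|[|k]] // _.
by rewrite !exprS; apply: (@eq_mod9 (q%:R ^+ 2 * (q * 3)%:R ^+ k)); rewrite natrM; ring.
Qed.

Lemma natr_exp_eq1_mod3 m r : (m %% 3 = 1)%N -> (r = 2 %[mod 3])%N ->
  m%:R ^+ r = m%:R ^+ 2 :> R.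
Proof.
move=> m1 r2; rewrite (divn_eq r 3) r2 mulnC exprD exprM.
suff -> : m%:R ^+ 3 = 1 :> R by rewrite expr1n mul1r.
rewrite (divn_eq m 3) m1; set q := (_ %/ _)%N.
by apply: (@eq_mod9 (3%:R * q%:R ^+ 3 + 3%:R * q%:R ^+ 2 + q%:R));
  rewrite natrD natrM; ring.
Qed.

(** The square of [m] has the form 3q + 1, whose cube is 1 modulo 9. *)
Lemma natr_exp_ndvd3 m s : ~~ (3 %| m)%N -> (s = 2 %[mod 6])%N ->
  m%:R ^+ s = m%:R ^+ 2 :> R.
Proof.
move=> m3 s2; rewrite (divn_eq s 6) s2 mulnC exprD exprM.
suff -> : m%:R ^+ 6 = 1 :> R by rewrite expr1n mul1r.
rewrite (exprM _ 2 3) -natrX.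
have m21 : (m ^ 2 %% 3 = 1)%N.
  have : (m %% 3 = 1 \/ m %% 3 = 2)%N by move: m3; lia.
  by rewrite -modnXm; case=> ->.
rewrite (divn_eq (m ^ 2) 3) m21; set q := (_ %/ _)%N.
by apply: (@eq_mod9 (3%:R * q%:R ^+ 3 + 3%:R * q%:R ^+ 2 + q%:R));
  rewrite natrD natrM; ring.
Qed.

(* The suffix de refers to the digits of the arguments 3 n + d and 3 k + e. *)
Lemma natr_bin00 n k : 'C(3 * n, 3 * k)%:R = 'C(n, k)%:R :> R.
Proof. exact/natr_mod9/jacobsthal9. Qed.

(** The inverse comes from (1 + 3a)(1 - 3a) = 1 - 9a^2. *)
Lemma mul_3aD1_inv (a : nat) (x y : R) :
  (3 * a + 1)%:R * x = y -> x = y * (1 - 3%:R * a%:R).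
Proof.
by move=> <-; apply: (@eq_mod9 (a%:R ^+ 2 * x)); rewrite natrD natrM; ring.
Qed.

Lemma mul_bin_addS a b : ((a + 1) * 'C(a + b + 1, b) = (a + b + 1) * 'C(a + b, b))%N.
Proof. by have := mul_bin_down (a + b + 1) b; rewrite addn1 /= => ->; congr muln; lia. Qed.

(** The ratio to ['C(3 * (a + b), 3 * b)] is (1 + 3(a + b)) / (1 + 3a), which is 1 + 3b modulo 9.
    Taking a + b as upper index avoids truncated subtraction. *)
Lemma natr_bin10 a b :
  'C(3 * (a + b) + 1, 3 * b)%:R = 'C(a + b, b)%:R * (1 + 3%:R * b%:R) :> R.
Proof.
have := mul_bin_addS (3 * a) (3 * b); rewrite -mulnDr => /(congr1 (GRing.natmul (1 : R))).
rewrite !natrM => /mul_3aD1_inv ->; rewrite natr_bin00.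
by apply: (@eq_mod9 (- 'C(a + b, b)%:R * (a%:R ^+ 2 + a%:R * b%:R)));
  rewrite !(natrD, natrM); ring.
Qed.

Lemma natr_bin20 a b : 'C(3 * (a + b) + 2, 3 * b)%:R = 'C(a + b, b)%:R :> R.
Proof.
have := mul_bin_addS (3 * a + 1) (3 * b).
have -> : (3 * a + 1 + 3 * b + 1 = 3 * (a + b) + 2)%N by lia.
have -> : (3 * a + 1 + 3 * b = 3 * (a + b) + 1)%N by lia.
move/(congr1 (GRing.natmul (1 : R))); rewrite !natrM natr_bin10.
set x := 'C(_, _)%:R; set c := 'C(_, _)%:R => E.
(* Doubling turns 3a + 2 into 3(2a + 1) + 1, the shape inverted by [mul_3aD1_inv]. *)
have {}E : (3 * (2 * a + 1) + 1)%:R * x = (3 * (2 * (a + b) + 1) + 1)%:R * (c * (1 + 3%:R * b%:R)).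
  transitivity (2%:R * ((3 * a + 1 + 1)%:R * x)).
    by rewrite !(natrD, natrM); ring.
  by rewrite E !(natrD, natrM); ring.
move/mul_3aD1_inv: E => ->.
pose A : R := a%:R; pose B : R := b%:R.
apply: (@eq_mod9 (c * (- 1 - 4%:R * A - 4%:R * B - 16%:R * A * B - 4%:R * B ^+ 2
  - 4%:R * A ^+ 2 - 12%:R * A ^+ 2 * B - 12%:R * A * B ^+ 2))).
rewrite !(natrD, natrM) -/A -/B; ring.
Qed.

Lemma mul_bin_succ a b : ((b + 1) * 'C(a + 1, b + 1) = (a + 1) * 'C(a, b))%N.
Proof. by rewrite !addn1 -mul_bin_diag. Qed.

Lemma natr_bin11 a b :
  'C(3 * (a + b) + 1, 3 * b + 1)%:R = 'C(a + b, b)%:R * (1 + 3%:R * a%:R) :> R.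
Proof.
have := mul_bin_succ (3 * (a + b)) (3 * b).
move/(congr1 (GRing.natmul (1 : R))); rewrite !natrM natr_bin00 => /mul_3aD1_inv ->.
apply: (@eq_mod9 (- 'C(a + b, b)%:R * (a%:R * b%:R + b%:R ^+ 2))).
by rewrite !(natrD, natrM); ring.
Qed.

Lemma natr_bin21 a b : 'C(3 * (a + b) + 2, 3 * b + 1)%:R =
  'C(a + b, b)%:R * (2%:R + 3%:R * (a%:R + b%:R)) :> R.
Proof.
have := mul_bin_succ (3 * (a + b) + 1) (3 * b).
rewrite -(addnA (3 * (a + b))%N).
move/(congr1 (GRing.natmul (1 : R))); rewrite !natrM natr_bin10 => /mul_3aD1_inv ->.
apply: (@eq_mod9 (- 'C(a + b, b)%:R * b%:R ^+ 2 * (2%:R + 3%:R * (a%:R + b%:R)))).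
by rewrite !(natrD, natrM); ring.
Qed.

Definition sqterm n k : R := ('C(n, k) * 'C(n + k, k))%:R ^+ 2.

Lemma sqterm_small n k : (n < k)%N -> sqterm n k = 0.
Proof. by move=> nk; rewrite /sqterm bin_small // mul0n expr0n. Qed.

Lemma sqterm_dvd3 n k :
  (3 %| 'C(n, k))%N || (3 %| 'C(n + k, k))%N -> sqterm n k = 0.
Proof.
by move=> h; apply: natr_dvd3_exp => //; case/orP: h; [apply: dvdn_mulr | apply: dvdn_mull].
Qed.

Lemma sqterm_digits n k d : (d < 3)%N ->
  sqterm (3 * n + d) (3 * k) + sqterm (3 * n + d) (3 * k + 1)
    + sqterm (3 * n + d) (3 * k + 2) = 5%:R ^+ (d == 1) * sqterm n k.
Proof.
have [nk|kn] := ltnP n k => d3; first by rewrite !sqterm_small ?mulr0 ?addr0 //; lia.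
have vanish e : (e < 3)%N -> (d < e)%N || (2 < d + e)%N ->
    sqterm (3 * n + d) (3 * k + e) = 0.
  move=> e3 /orP[de | carry]; apply: sqterm_dvd3; apply/orP; [left|right].
    exact: dvd3_bin.
  have -> : (3 * n + d + (3 * k + e) = 3 * (n + k).+1 + (d + e - 3))%N by lia.
  by apply: dvd3_bin => //; lia.
have nE : n = (n - k + k)%N by lia.
rewrite (vanish 2) ?addr0 //; last by lia.
case: d d3 vanish => [|[|[|//]]] _ vanish.
- rewrite (vanish 1) // addr0 mul1r /sqterm addn0 -mulnDr.
  by rewrite !natrM !natr_bin00.
- rewrite /sqterm.
  have -> : (3 * n + 1 + 3 * k = 3 * (n + k) + 1)%N by lia.
  have -> : (3 * n + 1 + (3 * k + 1) = 3 * (n + k) + 2)%N by lia.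
  rewrite !natrM natr_bin10 natr_bin21.
  have -> : 'C(3 * n + 1, 3 * k)%:R = 'C(n, k)%:R * (1 + 3%:R * k%:R) :> R.
    by rewrite nE natr_bin10.
  have -> : 'C(3 * n + 1, 3 * k + 1)%:R
      = 'C(n, k)%:R * (1 + 3%:R * (n%:R - k%:R)) :> R.
    by rewrite nE natr_bin11 natrD addrK.
  (* The factors for e = 1 multiply to 2 - 3K + 9V; the witness collects the excess over 5 of (1 +
     3K)^4 + (2 - 3K + 9V)^2. *)
  pose K : R := k%:R; pose V : R := n%:R + n%:R ^+ 2 - K ^+ 2.
  apply: (@eq_mod9 (('C(n, k)%:R * 'C(n + k, k)%:R) ^+ 2
    * (7%:R * K ^+ 2 + 12%:R * K ^+ 3 + 9%:R * K ^+ 4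
       + 2%:R * V * (2%:R - 3%:R * K) + 9%:R * V ^+ 2))).
  by rewrite /V /K /=; ring.
- rewrite (vanish 1) // addr0 mul1r /sqterm.
  have -> : (3 * n + 2 + 3 * k = 3 * (n + k) + 2)%N by lia.
  by rewrite !natrM natr_bin20 nE natr_bin20 -nE.
Qed.

Lemma natr_apery r s n :
  (0 < r)%N -> (0 < s)%N -> (r = 2 %[mod 3])%N -> (s = 2 %[mod 6])%N ->
  (apery r s n)%:R = \sum_(0 <= k < n.+1) sqterm n k.
Proof.
move=> r0 s0 r2 s2; rewrite /apery natr_sum; apply: eq_bigr => k _.
(* Exponents of at least 2 let a single factor 3 in either binomial annihilate the summand. *)
have r1 : (1 < r)%N by case: (r) r0 r2 => [|[]].
have s1 : (1 < s)%N by case: (s) s0 s2 => [|[]].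
have [dA|ndA] := boolP (3 %| 'C(n, k))%N.
  by rewrite natrM !natrX natr_dvd3_exp // mul0r sqterm_dvd3 ?dA.
have [dB|ndB] := boolP (3 %| 'C(n + k, k))%N.
  by rewrite natrM !natrX (natr_dvd3_exp _ s) // mulr0 sqterm_dvd3 ?dB ?orbT.
rewrite natrM !natrX natr_exp_eq1_mod3 ?bin_mod3_eq1 // natr_exp_ndvd3 //.
by rewrite /sqterm natrM exprMn.
Qed.

Lemma sum_sqterm_digit n d : (d < 3)%N ->
  \sum_(0 <= k < (3 * n + d).+1) sqterm (3 * n + d) k
    = 5%:R ^+ (d == 1) * \sum_(0 <= k < n.+1) sqterm n k.
Proof.
(* Padding with zero terms makes the range a union of blocks of three, one for each leading part
   k. *)
move=> d3; transitivity (\sum_(0 <= k < n.+1 * 3) sqterm (3 * n + d) k).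
  rewrite [RHS](big_cat_nat (n := (3 * n + d).+1)) //=; last by lia.
  rewrite [X in _ + X]big_nat_cond [X in _ + X]big1 ?addr0 // => k.
  by rewrite andbT => /andP[kn _]; apply: sqterm_small; lia.
rewrite big_nat_mul mulr_sumr; apply: eq_bigr => k _.
rewrite -sqterm_digits // mulSn addnC (mulnC k) addn3 !big_nat_recr ?big_geq //=; try lia.
by rewrite add0r addn1 addn2.
Qed.

Lemma sum_sqterm n :
  \sum_(0 <= k < n.+1) sqterm n k = 5%:R ^+ count_mem 1%N (ternary n).
Proof.
elim/ltn_ind: n => -[_|n IHn].
  by rewrite big_nat1 /sqterm !bin0 expr1n.
rewrite (divn_eq n.+1 3) mulnC count_ternary ?ltn_mod // exprD.
by rewrite sum_sqterm_digit ?ltn_mod // IHn //; lia.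
Qed.

End Mod9.

(** * Residues modulo 9 and the classification *)

Lemma apery_mod9 r s n :
  0 < r -> 0 < s -> r = 2 %[mod 3] -> s = 2 %[mod 6] ->
  apery r s n = 5 ^ count_mem 1 (ternary n) %[mod 9].
Proof.
move=> r0 s0 r2 s2.
have Z9 : (9%:R = 0 :> 'Z_9)%R by apply/val_inj; rewrite [LHS](@val_Zp_nat 9).
suff : ((apery r s n)%:R = (5 ^ count_mem 1 (ternary n))%:R :> 'Z_9)%R.
  by move/(congr1 val); rewrite [LHS](@val_Zp_nat 9) // [RHS](@val_Zp_nat 9).
by rewrite natr_apery // sum_sqterm // GRing.natrX.
Qed.

(** The order of 5 modulo 9 is 6; the list is its cycle of powers. *)
Lemma expn5_mod9 m : 5 ^ m %% 9 = nth 0 [:: 1; 5; 7; 8; 4; 2] (m %% 6).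
Proof.
rewrite [in LHS](divn_eq m 6) mulnC expnD expnM -modnMml -modnXm.
rewrite (_ : 5 ^ 6 %% 9 = 1) // exp1n modnMml mul1n.
by move: (m %% 6) (ltn_pmod m (isT : 0 < 6)) => [|[|[|[|[|[|]]]]]].
Qed.

Theorem corollary25 (r s : nat) (hr0 : 0 < r) (hs0 : 0 < s)
    (hr : r = 2 %[mod 3]) (hs : s = 2 %[mod 6]) :
  (forall n : nat,
     apery r s n = 1 %[mod 9] <-> exists k : nat, ternary_ones n (6 * k)) /\
  (forall n : nat,
     apery r s n = 2 %[mod 9] <-> exists k : nat, ternary_ones n (6 * k + 5)) /\
  (forall n : nat,
     apery r s n = 4 %[mod 9] <-> exists k : nat, ternary_ones n (6 * k + 4)) /\
  (forall n : nat,
     apery r s n = 5 %[mod 9] <-> exists k : nat, ternary_ones n (6 * k + 1)) /\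
  (forall n : nat,
     apery r s n = 7 %[mod 9] <-> exists k : nat, ternary_ones n (6 * k + 2)) /\
  (forall n : nat,
     apery r s n = 8 %[mod 9] <-> exists k : nat, ternary_ones n (6 * k + 3)) /\
  (forall n : nat,
     ~ (exists k : nat,
          ternary_ones n (6 * k) \/ ternary_ones n (6 * k + 5) \/
          ternary_ones n (6 * k + 4) \/ ternary_ones n (6 * k + 1) \/
          ternary_ones n (6 * k + 2) \/ ternary_ones n (6 * k + 3)) ->
     9 %| apery r s n) /\
  (forall n : nat,
     apery r s n <> 3 %[mod 9] /\ apery r s n <> 6 %[mod 9]).
Proof.
have aperyE n : apery r s n %% 9
    = nth 0 [:: 1; 5; 7; 8; 4; 2] (count_mem 1 (ternary n) %% 6).
  by rewrite apery_mod9 // expn5_mod9.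
have classify c j n : j < 6 -> c = nth 0 [:: 1; 5; 7; 8; 4; 2] j ->
    apery r s n = c %[mod 9] <-> exists k, ternary_ones n (6 * k + j).
  move=> j6 ->; rewrite aperyE; set m := count_mem 1 _; split=> [eq_j|[k]].
    exists (m %/ 6); apply/ternary_onesE; rewrite -/m.
    suff <- : m %% 6 = j by rewrite mulnC -divn_eq.
    (* The six entries are distinct and below 9, so the residue determines the index. *)
    move: eq_j; have := ltn_pmod m (isT : 0 < 6).
    by move: j j6 (m %% 6) => [|[|[|[|[|[|]]]]]] // _ [|[|[|[|[|[|]]]]]].
  move/ternary_onesE; rewrite -/m => ->.
  rewrite mulnC modnMDl modn_small //.
  by move: j j6 => [|[|[|[|[|[|]]]]]].
have classify0 n : apery r s n = 1 %[mod 9] <-> exists k, ternary_ones n (6 * k).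
  rewrite (classify 1 0) //.
  by split=> -[k hk]; exists k; move: hk; rewrite addn0.
do ![split; first by move=> n; first [exact: classify0 | exact: classify]].
split=> n; last first.
  by rewrite aperyE; case: (_ %% 6) (ltn_pmod (count_mem 1 (ternary n)) (isT : 0 < 6))
    => [|[|[|[|[|[|]]]]]].
(* Each count falls in one of the six classes modulo 6, which contradicts the assumption. *)
case; set m := count_mem 1 (ternary n); exists (m %/ 6).
rewrite !ternary_onesE -/m; lia.
Qed.
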